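(* Let $(\mathbb{V},\mathbb{W},\lambda)$ be a finite-dimensional FTvN system, let $(\mathbb{W},\mathbb{W},\mu)$ be a reduced system of $(\mathbb{V},\mathbb{W},\lambda)$, and let $\mathcal{C}\subseteq\mathbb{W}$ be a nonempty spectral set in $(\mathbb{W},\mathbb{W},\mu)$. Then $$\mathsf{conv}\,\lambda^{-1}(\mathcal{C})=\lambda^{-1}(\mathsf{conv}\,\mathcal{C}).$$
   Context: Let $\mathbb{V},\mathbb{W}$ be finite-dimensional real inner-product spaces and $\lambda:\mathbb{V}\to\mathbb{W}$ a (generally nonlinear) map. $(\mathbb{V},\mathbb{W},\lambda)$ is called an FTvN system if: (P1) $\langle x,y\rangle\le\langle\lambda(x),\lambda(y)\rangle$ for all $x,y\in\mathbb{V}$; and (P2) for all $c\in\mathbb{V}$ and $u\in\lambda(\mathbb{V})$ there exists $x\in\mathbb{V}$ such that $\lambda(x)=u$ and $\langle c,x\rangle=\langle\lambda(c),\lambda(x)\rangle$. In this case the range $\mathcal{K}:=\lambda(\mathbb{V})\subseteq\mathbb{W}$ is known to be a nonempty closed convex cone. An FTvN system $(\mathbb{W},\mathbb{W},\mu)$ is called a reduced system of $(\mathbb{V},\mathbb{W},\lambda)$ if $\mu(u)=u$ for all $u\in\mathcal{K}$ and $\mu(\mathbb{W})=\lambda(\mathbb{V})=\mathcal{K}$. A set $\mathcal{C}\subseteq\mathbb{W}$ is spectral in $(\mathbb{W},\mathbb{W},\mu)$ if $\mathcal{C}=\mu^{-1}(\mathcal{Q})$ for some $\mathcal{Q}\subseteq\mathbb{W}$.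 $\lambda^{-1}(\mathcal{A})$, $\mu^{-1}(\mathcal{A})$ denote preimages of a set $\mathcal{A}\subseteq\mathbb{W}$, and $\mathsf{conv}$ denotes convex hull. *)

(* Defs.v *)
From HB Require Import structures.
From mathcomp Require Import all_boot all_order all_algebra.
From mathcomp Require Import boolp classical_sets reals convex.

Set Implicit Arguments.
Unset Strict Implicit.
Unset Printing Implicit Defensive.

Import Order.TTheory GRing.Theory Num.Theory.

Local Open Scope classical_set_scope.
Local Open Scope ring_scope.

(* A finite-dimensional real inner-product space is V : vectType R (R : realType)
   together with a form dV : {dot V for idfun}: since theta is idfun, such a form
   is bilinear, symmetric and positive definite. *)

Definition convex_hull (R : realType) (V : vectType R) (A : set V) : set V :=
  smallest (fun B : set V => convex_set (B : set (convex_lmodType V))) A.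

Record FTvN_system (R : realType) (V W : vectType R)
    (dV : {dot V for (@idfun R)}) (dW : {dot W for (@idfun R)})
    (lambda : V -> W) : Prop := {
  FTvN_le : forall x y : V, dV x y <= dW (lambda x) (lambda y);
  FTvN_attained : forall (c : V) (u : W), range lambda u ->
    exists x : V, lambda x = u /\ dV c x = dW (lambda c) (lambda x)
}.

Record reduced_system (R : realType) (V W : vectType R)
    (dW : {dot W for (@idfun R)})
    (lambda : V -> W) (mu : W -> W) : Prop := {
  reduced_FTvN : FTvN_system dW dW mu;
  reduced_fix : forall u : W, range lambda u -> mu u = u;
  reduced_range : range mu = range lambda
}.

Definition spectral_set (R : realType) (V W : vectType R) (mu : V -> W)
    (C : set V) : Prop :=
  exists Q : set W, C = mu @^-1` Q.

(* Main.v *)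
(* For q in the range of lambda, P2 says that the fiber lambda^-1(q) has support
   function c |-> <lambda c, q>. Together with P1 it makes the fiber compact, so
   its convex hull is compact as well, by Caratheodory's theorem. Hence, if
   x satisfies <c, x> <= sum_i t_i <lambda c, q_i> for all c, with convex weights
   t_i, then x lies in the compact convex set sum_i t_i conv lambda^-1(q_i),
   because a nearest-point separation would violate the inequality.
   Both inclusions are instances of this remark.
   If lambda x = sum_i t_i c_i with c_i in C, take q_i = mu c_i, which is again
   in C: <c, x> <= <lambda c, lambda x> <= sum_i t_i <lambda c, mu c_i>.
   If x = sum_i t_i x_i with lambda x_i in C, apply it to the system mu with
   q_i = lambda x_i: given w, P2 yields d such that lambda d = mu w and
   <w, lambda x> <= <mu w, lambda x> = <d, x> <= sum_i t_i <mu w, lambda x_i>. *)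
Require Import Defs.
From mathcomp Require Import all_boot all_order all_algebra.
From mathcomp Require Import boolp classical_sets reals convex.
From mathcomp Require Import interval_inference topology normedtype derive lra.

Set Implicit Arguments.
Unset Strict Implicit.

Import Order.TTheory GRing.Theory Num.Theory.
Import VectorInternalTheory.
Import numFieldNormedType.Exports.

Local Open Scope classical_set_scope.
Local Open Scope ring_scope.

(** * Convex hulls and Caratheodory's theorem *)

Lemma convex_setP (R : realType) (V : lmodType R) (A : set V) :
  convex_set (A : set (convex_lmodType V)) <->
  forall (x y : V) (t : R), 0 <= t <= 1 -> A x -> A y ->
    A (t *: x + (1 - t) *: y).
Proof.
split=> [cA x y t /andP[t0 t1] Ax Ay|cA x y t].
  by have := cA x y (Itv01 t0 t1); rewrite !inE; exact.
rewrite !inE => Ax Ay; apply: cA => //.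
by apply/andP; split; [exact: ge0|exact: le1].
Qed.

Lemma sub_convex_hull (R : realType) (V : vectType R) (A : set V) :
  A `<=` convex_hull A.
Proof. exact: sub_gen_smallest. Qed.

Lemma convex_hull_sub (R : realType) (V : vectType R) (A B : set V) :
  convex_set (B : set (convex_lmodType V)) -> A `<=` B -> convex_hull A `<=` B.
Proof. exact: smallest_sub. Qed.

Lemma convex_convex_hull (R : realType) (V : vectType R) (A : set V) :
  convex_set (convex_hull A : set (convex_lmodType V)).
Proof.
apply/convex_setP => x y t t01 hx hy B [cB AB].
by move/convex_setP: (cB); apply => //; [exact: hx|exact: hy].
Qed.

Lemma convex_hullS (R : realType) (V : vectType R) (A B : set V) :
  A `<=` B -> convex_hull A `<=` convex_hull B.
Proof.
by move=> AB; apply: convex_hull_sub;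
  [exact: convex_convex_hull|exact: subset_trans (@sub_convex_hull _ _ _)].
Qed.

(* [conv_join A k] consists of the convex combinations of [k.+1] points of [A]
   (with repetitions allowed). *)
Fixpoint conv_join (R : realType) (V : lmodType R) (A : set V) (k : nat) : set V :=
  if k is k'.+1 then
    [set z | exists t x y, [/\ 0 <= t <= 1, A x, conv_join A k' y &
                               z = t *: x + (1 - t) *: y]]
  else A.

Lemma sub_conv_join (R : realType) (V : lmodType R) (A : set V) k :
  A `<=` conv_join A k.
Proof.
elim: k => [|k IH] //= x Ax; exists 1, x, x; split=> //; first by rewrite ler01 lexx.
  exact: IH.
by rewrite subrr scale0r addr0 scale1r.
Qed.

Lemma conv_join_sub_hull (R : realType) (V : vectType R) (A : set V) k :
  conv_join A k `<=` convex_hull A.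
Proof.
elim: k => [|k IH] /=; first exact: sub_convex_hull.
move=> _ [t [x [y [t01 Ax Ay ->]]]].
move/convex_setP: (@convex_convex_hull R V A); apply => //; last exact: IH.
exact: sub_convex_hull.
Qed.

(** Peel off one index [i0] and divide the other weights by [1 - t i0]; if this is 0, all of them
    vanish and only [s i0] remains. *)
Lemma conv_join_sum (R : realType) (V : lmodType R) (A : set V)
    (T : finType) (s : T -> V) (sA : forall i, A (s i)) k (P : {set T})
    (t : T -> R) :
  (#|P| <= k.+1)%N -> (forall i, 0 <= t i) -> \sum_(i in P) t i = 1 ->
  conv_join A k (\sum_(i in P) t i *: s i).
Proof.
elim: k P t => [|k IH] P t cP t0 t1;
  (have [P0|[i0 Pi0]] := set_0Vmem P;
    first by move/eqP: t1; rewrite P0 big_set0 eq_sym oner_eq0);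
  (have t1' : 1 - t i0 = \sum_(i in P :\ i0) t i
    by rewrite -t1 (big_setD1 i0 Pi0) /= addrAC subrr add0r);
  rewrite (big_setD1 i0 Pi0) /=;
  move: cP; rewrite (cardsD1 i0) Pi0 add1n ltnS => cP.
  move: cP t1'; rewrite leqn0 cards_eq0 => /eqP ->; rewrite !big_set0.
  by move=> /eqP; rewrite subr_eq0 => /eqP <-; rewrite scale1r addr0.
have u0 : 0 <= 1 - t i0 by rewrite t1' sumr_ge0.
have [u1|u1] := eqVneq (1 - t i0) 0.
  rewrite u1 in t1'.
  rewrite big1 => [|i Pi]; last first.
    by rewrite (psumr_eq0P (fun j _ => t0 j) (esym t1') Pi) ?scale0r.
  move/eqP: u1; rewrite subr_eq0 => /eqP <-; rewrite scale1r addr0.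
  exact: (@sub_conv_join _ _ A k.+1).
exists (t i0), (s i0), (\sum_(i in P :\ i0) ((1 - t i0)^-1 * t i) *: s i); split=> //.
- by rewrite t0 -subr_ge0.
- apply: IH => //; first by move=> i; rewrite mulr_ge0 ?invr_ge0.
  by rewrite -mulr_sumr -t1' mulVf.
- congr (_ + _); rewrite scaler_sumr; apply: eq_bigr => i _.
  by rewrite scalerA mulrA divff // mul1r.
Qed.

Lemma v2rD (R : realType) (V : vectType R) (x y : V) : v2r (x + y) = v2r x + v2r y.
Proof. exact: (@raddfD V 'rV_(dim V) v2r). Qed.

Lemma v2rZ (R : realType) (V : vectType R) (a : R) (x : V) : v2r (a *: x) = a *: v2r x.
Proof. exact: (@linearZ_LR R V 'rV_(dim V) *:%R v2r). Qed.

(** More than [dim V + 1] rows [(v2r (s i), 1)] are linearly dependent. The last coordinate forces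
    the coefficients to sum to 0, so one of them is positive. *)
Lemma affine_dependence (R : realType) (V : vectType R) (T : finType)
    (s : T -> V) (P : {set T}) :
  (dim V + 1 < #|P|)%N ->
  exists u : T -> R, [/\ forall i, i \notin P -> u i = 0,
    exists i, 0 < u i, \sum_i u i = 0 & \sum_i u i *: s i = 0].
Proof.
move=> cP.
have /card_gt0P[x0 Px0] : (0 < #|P|)%N by exact: leq_ltn_trans cP.
pose M := \matrix_(i < #|P|) row_mx (v2r (s (enum_val i))) (1 : 'rV[R]_1).
have : ~~ row_free M.
  by apply/negP => /eqP rM; move: cP; rewrite -rM ltnNge rank_leq_col.
rewrite -kermx_eq0 => /rowV0Pn[w /sub_kermxP wM w0].
pose u i := if i \in P then w 0 (enum_rank_in Px0 i) else 0.
have uP i : i \notin P -> u i = 0 by rewrite /u => /negPf ->.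
have uval k : u (enum_val k) = w 0 k by rewrite /u enum_valP enum_valK_in.
have sumE (E : zmodType) (F : R -> T -> E) : (forall i, F 0 i = 0) ->
    \sum_i F (u i) i = \sum_k F (w 0 k) (enum_val k).
  move=> F0; rewrite (bigID (mem P)) /= [X in _ + X]big1 ?addr0; last first.
    by move=> i /uP ->.
  by rewrite big_enum_val; apply: eq_bigr => k _; rewrite uval.
have wME j : \sum_k w 0 k * M k j = 0.
  by have /rowP/(_ j) := wM; rewrite !mxE.
have us : \sum_i u i *: s i = 0.
  rewrite (sumE _ (fun a i => a *: s i)); last by move=> i; rewrite scale0r.
  apply: v2r_inj; rewrite raddf_sum raddf0; apply/rowP => j.
  rewrite summxE mxE -[RHS](wME (lshift 1 j)); apply: eq_bigr => k _.
  by rewrite /= v2rZ mxE [M _ _]mxE row_mxEl.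
have u1 : \sum_i u i = 0.
  rewrite (sumE _ (fun a i => a)) // -[RHS](wME (rshift _ 0)).
  by apply: eq_bigr => k _; rewrite [M _ _]mxE row_mxEr mxE mulr1.
exists u; split=> //; apply: contrapT => /forallNP un.
have {}un i : 0 <= - u i by rewrite oppr_ge0 leNgt; apply/negP/un.
case/negP: w0; apply/eqP/rowP => k; rewrite mxE -uval; apply/eqP.
rewrite -oppr_eq0; apply/eqP; apply: (psumr_eq0P (P := xpredT) (fun i _ => un i)) => //.
by rewrite sumrN u1 oppr0.
Qed.

Lemma caratheodory_reduction (R : realType) (V : vectType R) (T : finType)
    (s : T -> V) (t : T -> R) :
  (forall i, 0 <= t i) ->
  exists t' : T -> R, [/\ forall i, 0 <= t' i, (#|[set i | t' i != 0%R]%SET| <= dim V + 1)%N,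
    \sum_i t' i = \sum_i t i & \sum_i t' i *: s i = \sum_i t i *: s i].
Proof.
have [m] := ubnP #|[set i | t i != 0%R]%SET|.
elim: m t => // m IH t; rewrite ltnS => tm t0.
have [tV|tV] := leqP #|[set i | t i != 0%R]%SET| (dim V + 1)%N.
  by exists t.
have [u [uP [i1 ui1] u1 us]] := affine_dependence s tV.
(* The ratio at [i0] is the largest multiple of [u] that can be subtracted from [t] keeping all
   weights nonnegative; it cancels the weight at [i0], so the support shrinks. *)
pose i0 := [arg min_(i < i1 | 0 < u i) (t i / u i)]%O.
have [ui0 i0min] : 0 < u i0 /\ forall i, 0 < u i -> t i0 / u i0 <= t i / u i.
  by rewrite /i0; case: arg_minP => // i ui imin; split.
pose a := t i0 / u i0; pose t' i := t i - a * u i.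
have t'0 i : 0 <= t' i.
  rewrite subr_ge0; have [ui|ui] := ltP 0 (u i).
    by rewrite -ler_pdivlMr // i0min.
  by rewrite (le_trans _ (t0 i)) // mulr_ge0_le0 // divr_ge0 // ltW.
have /IH : (#|[set i | t' i != 0%R]%SET| < m)%N.
  apply: leq_trans tm; apply: proper_card; apply/properP; split.
    apply/fintype.subsetP => i; rewrite !inE; apply: contraNneq => ti.
    by rewrite /t' ti uP ?mulr0 ?subrr // inE ti eqxx.
  exists i0; last by rewrite inE negbK /t' /a divfK ?subrr // gt_eqF.
  by rewrite inE; apply: contraTneq ui0 => ti; rewrite uP ?ltxx // inE ti eqxx.
move=> /(_ t'0)[v [v0 cv v1 vs]]; exists v; split=> //.
  by rewrite v1 sumrB -mulr_sumr u1 mulr0 subr0.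
rewrite vs; under eq_bigr do rewrite scalerBl -scalerA.
by rewrite sumrB -scaler_sumr us scaler0 subr0.
Qed.

Lemma convex_hull_comb (R : realType) (V : vectType R) (A : set V) (x : V) :
  convex_hull A x ->
  exists (T : finType) (t : T -> R) (s : T -> V), [/\ forall i, 0 <= t i,
    \sum_i t i = 1, forall i, A (s i) & x = \sum_i t i *: s i].
Proof.
move: x; apply: convex_hull_sub => [|x Ax]; last first.
  exists 'I_1, (fun=> 1), (fun=> x); split=> //; first by rewrite big_ord1.
  by rewrite big_ord1 scale1r.
apply/convex_setP => _ _ p /andP[p0 p1] [T1 [t1 [s1 [t10 t11 s1A ->]]]]
  [T2 [t2 [s2 [t20 t21 s2A ->]]]].
(* Two combinations are concatenated over the disjoint union of their index types. *)
exists (T1 + T2)%type.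
exists (fun i => match i with inl j => p * t1 j | inr j => (1 - p) * t2 j end).
exists (fun i => match i with inl j => s1 j | inr j => s2 j end); split.
- by case=> i; rewrite mulr_ge0 // subr_ge0.
- by rewrite big_sumType /= -!mulr_sumr t11 t21 !mulr1 addrC subrK.
- by case.
- rewrite big_sumType /= !scaler_sumr.
  by congr (_ + _); apply: eq_bigr => i _; rewrite scalerA.
Qed.

Lemma caratheodory (R : realType) (V : vectType R) (A : set V) :
  convex_hull A = conv_join A (dim V).
Proof.
apply/seteqP; split; last exact: conv_join_sub_hull.
move=> _ /convex_hull_comb[T [t [s [t0 t1 sA ->]]]].
have [u [u0 cu u1 <-]] := caratheodory_reduction s t0.
have suppE (E : zmodType) (F : R -> T -> E) : (forall i, F 0 i = 0) ->
    \sum_i F (u i) i = \sum_(i in [set i | u i != 0%R]%SET) F (u i) i.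
  move=> F0; rewrite [RHS]big_mkcond; apply: eq_bigr => i _.
  by rewrite inE; case: eqP => //= ->.
rewrite (suppE _ (fun a i => a *: s i)); last by move=> i; rewrite scale0r.
apply: conv_join_sum => //; first by rewrite addn1 in cu.
by rewrite -t1 -u1 (suppE _ (fun a _ => a)).
Qed.

(** * Compactness of convex hulls *)

(** [T] is the unit interval for convex hulls and a singleton for Minkowski combinations of fixed
    weight. *)
Lemma compact_conv_comb (R : realType) (V : vectType R) (T : set R) (A B : set V) :
  compact T -> compact (v2r @` A) -> compact (v2r @` B) ->
  compact (v2r @` [set z | exists t x y,
    [/\ T t, A x, B y & z = t *: x + (1 - t) *: y]]).
Proof.
move=> cT cA cB.
pose phi (p : (R * 'rV[R]_(dim V)) * 'rV[R]_(dim V)) :=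
  p.1.1 *: p.1.2 + (1 - p.1.1) *: p.2.
have cphi : continuous phi.
  move=> p; apply: cvgD; apply: cvgZ.
  - by apply: (cvg_comp fst fst); [exact: cvg_fst|exact: cvg_fst].
  - by apply: (cvg_comp fst snd); [exact: cvg_fst|exact: cvg_snd].
  - apply: cvgB; first exact: cvg_cst.
    by apply: (cvg_comp fst fst); [exact: cvg_fst|exact: cvg_fst].
  - exact: cvg_snd.
have := continuous_compact (continuous_subspaceT cphi)
  (compact_setX (compact_setX cT cA) cB).
congr compact; apply/seteqP; split=> [_ [[[t _] _] [[/= Tt [x Ax <-]] [y By <-]] <-]|].
  by exists (t *: x + (1 - t) *: y); [exists t, x, y|rewrite v2rD !v2rZ].
move=> _ [_ [t [x [y [Tt Ax By ->]]]] <-].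
exists ((t, v2r x), v2r y); last by rewrite v2rD !v2rZ.
by split; [split=> //; exists x|exists y].
Qed.

Lemma compact_convex_hull (R : realType) (V : vectType R) (A : set V) :
  compact (v2r @` A) -> compact (v2r @` convex_hull A).
Proof.
move=> cA; rewrite caratheodory.
suff all k : compact (v2r @` conv_join A k) by exact: all.
elim: k => [|k IH] //=.
have := compact_conv_comb (@segment_compact R 0 1) cA IH.
by congr compact; congr image; apply/seteqP; split=> z [t [x [y]]];
  rewrite /= in_itv /= => H; exists t, x, y.
Qed.

(** * Inner products: continuity, Riesz vectors and separation *)

Section Dot.
Variables (R : realType) (V : vectType R) (dV : {dot V for (@idfun R)}).

Lemma dotC x y : dV x y = dV y x.
Proof. by have := hermC dV x y; rewrite expr0 mul1r. Qed.

Lemma dotDr x y z : dV x (y + z) = dV x y + dV x z.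
Proof. exact: linearDr. Qed.

Lemma dotZr x a y : dV x (a *: y) = a * dV x y.
Proof. exact: (linearZr_LR dV). Qed.

Lemma dotDl x y z : dV (y + z) x = dV y x + dV z x.
Proof. exact: linearDl. Qed.

Lemma dotZl x a y : dV (a *: y) x = a * dV y x.
Proof. exact: linearZl_LR. Qed.

Lemma dotBr x y z : dV x (y - z) = dV x y - dV x z.
Proof. exact: linearBr. Qed.

Lemma dotBl x y z : dV (y - z) x = dV y x - dV z x.
Proof. exact: linearBl. Qed.

Lemma dot_gt0 x : x != 0 -> 0 < dV x x.
Proof. exact: neq0_dnorm_gt0. Qed.

Lemma dot_ge0 x : 0 <= dV x x.
Proof. by have [->|/dot_gt0/ltW//] := eqVneq x 0; rewrite linear0r. Qed.

Lemma dot_r2v (a : 'rV[R]_(dim V)) x :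
  dV (r2v a) x = \sum_j a 0 j * dV (r2v 'e_j) x.
Proof.
rewrite [in LHS](row_sum_delta a) raddf_sum /= linear_sumlz.
by apply: eq_bigr => j _; rewrite linearZ_LR /= dotZl.
Qed.

(** Constant [F j] give linear functionals; letting [F j] depend on [a] covers the squared norm
    too. *)
Lemma continuous_row_sum n (F : 'I_n -> 'rV[R]_n -> R) :
  (forall j, continuous (F j)) -> continuous (fun a : 'rV[R]_n => \sum_j a 0 j * F j a).
Proof.
move=> cF; apply: (continuous_big (@add_continuous R)) => j _.
suff : continuous ((fun a : 'rV[R]_n => a 0 j) \* F j) by [].
by move=> a; apply: continuousM; [exact: coord_continuous|exact: cF].
Qed.

Lemma continuous_dot_r2v x : continuous (fun a : 'rV[R]_(dim V) => dV (r2v a) x).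
Proof.
under eq_fun do rewrite dot_r2v.
by apply: continuous_row_sum => j; exact: cst_continuous.
Qed.

Lemma continuous_sqnorm_r2v :
  continuous (fun a : 'rV[R]_(dim V) => dV (r2v a) (r2v a)).
Proof.
under eq_fun do rewrite dot_r2v.
apply: continuous_row_sum => j; under eq_fun do rewrite dotC.
exact: continuous_dot_r2v.
Qed.

(* Riesz representation of the coordinate functionals, by inverting the Gram
   matrix. *)
Lemma coord_dot (j : 'I_(dim V)) : exists c : V, forall x, v2r x 0 j = dV x c.
Proof.
pose G := \matrix_(i, k) dV (r2v 'e_i) (r2v 'e_k) : 'M[R]_(dim V).
have GE x w : dV x (r2v w) = (v2r x *m G *m w^T) 0 0.
  rewrite -{1}(v2rK x) dot_r2v -mulmxA mxE; apply: eq_bigr => i _; congr (_ * _).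
  rewrite dotC dot_r2v mxE; apply: eq_bigr => k _.
  by rewrite [w^T _ _]mxE [G _ _]mxE mulrC dotC.
(* By positive definiteness: [w *m G = 0] makes the squared norm of [r2v w] vanish. *)
have Gunit : G \in unitmx.
  rewrite -row_free_unit; apply: inj_row_free => w wG.
  apply: (@r2v_inj _ V); rewrite raddf0; apply/eqP/negPn/negP => /dot_gt0.
  by rewrite GE r2vK wG mul0mx mxE ltxx.
exists (r2v (col j (invmx G))^T) => x.
by rewrite GE trmxK -mulmxA colE (mulmxA G) mulmxV // mul1mx -colE mxE.
Qed.

(* A compact convex set is the intersection of its supporting half-spaces: the
   point of [B] nearest to [x] separates [x] from [B]. *)
Lemma mem_compact_convex (B : set V) (x : V) :
  convex_set (B : set (convex_lmodType V)) -> compact (v2r @` B) ->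
  (forall c, exists2 b, B b & dV c x <= dV c b) -> B x.
Proof.
move=> /convex_setP cB kB sB; have [b0 Bb0 _] := sB 0.
(* Squared distance from [r2v a] to [x], up to the constant [dV x x]. *)
pose g (a : 'rV[R]_(dim V)) := dV (r2v a) (r2v a) - 2 * dV (r2v a) x.
have cg : continuous g.
  suff : continuous ((fun a : 'rV[R]_(dim V) => dV (r2v a) (r2v a)) \-
    ((fun=> 2) \* (fun a : 'rV[R]_(dim V) => dV (r2v a) x))) by [].
  move=> a; apply: continuousB; first exact: continuous_sqnorm_r2v.
  by apply: continuousM; [exact: cst_continuous|exact: continuous_dot_r2v].
have [|_ /set_mem[y By <-] ymin] := EVT_min_rV _ kB (continuous_subspaceT cg).
  by exists (v2r b0), b0.
suff /eqP/subr0_eq -> : x - y == 0 by [].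
apply/negPn/negP => /dot_gt0; set c := x - y.
have key b : B b -> dV c b <= dV c y.
  move=> Bb; rewrite -subr_le0 -dotBr; set d := b - y.
  rewrite leNgt; apply/negP => cd.
  have dd : 0 <= dV d d by exact: dot_ge0.
  (* Moving from [y] to [y + t *: d] changes [g] by [t ^ 2 * dV d d - 2 * t * dV c d]. This [t] is
     at most 1 and makes the change [- t * (1 + t) * dV c d], which is negative. *)
  pose t := dV c d / (dV c d + dV d d).
  have D0 : 0 < dV c d + dV d d by rewrite ltr_pwDl.
  have t0 : 0 < t by rewrite divr_gt0.
  have t1 : t <= 1 by rewrite ler_pdivrMr // mul1r lerDl.
  have := ymin (v2r (t *: b + (1 - t) *: y)).
  have Bt : B (t *: b + (1 - t) *: y) by apply: cB => //; rewrite ltW.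
  rewrite /g !v2rK inE => /(_ (imageP _ Bt)).
  have -> : t *: b + (1 - t) *: y = y + t *: d.
    by rewrite /d scalerBr scalerBl scale1r addrCA addrA.
  have yd : dV y d = dV x d - dV c d by rewrite /c dotBl opprB addrCA subrr addr0.
  have tD : t * (dV c d + dV d d) = dV c d by rewrite divfK // gt_eqF.
  clearbody d c t; rewrite !(dotDl, dotDr, dotZl, dotZr) (dotC d y) leNgt => /negP; apply.
  rewrite yd (dotC d x); have := mulr_gt0 t0 cd; nra.
have [b Bb] := sB c; move/(fun h => le_trans h (key b Bb)).
by rewrite -subr_le0 -dotBr leNgt => /negP.
Qed.

End Dot.

(** * Fibers of an FTvN system and hull membership *)

Section FTvN.
Variables (R : realType) (V W : vectType R).
Variables (dV : {dot V for (@idfun R)}) (dW : {dot W for (@idfun R)}).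
Variable lambda : V -> W.
Hypothesis hlambda : FTvN_system dV dW lambda.

(** P2 gives [y] in the fiber of [x] with [dV x y] equal to the squared norm of [lambda x].
    Expanding [0 <= dV (x - y) (x - y)] and bounding [dV y y] by P1 yields the inequality opposite
    to P1 at [x]. *)
Lemma FTvN_norm x : dW (lambda x) (lambda x) = dV x x.
Proof.
have [y [ly xy]] := FTvN_attained hlambda x (imageT lambda x).
have le_yy := FTvN_le hlambda y y; have le_xx := FTvN_le hlambda x x.
rewrite ly in xy le_yy.
have : 0 <= dV (x - y) (x - y) by exact: dot_ge0.
rewrite !(dotBl, dotBr) (dotC dV y x) xy; lra.
Qed.

(* The points of the second set satisfy [|lambda x - q|^2 <= 0]. *)
Lemma FTvN_fiberE q :
  lambda @^-1` [set q] = [set x | (forall c, dV x c <= dW (lambda c) q) /\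
                                   dV x x = dW q q].
Proof.
apply/seteqP; split=> x /= => [<-|[xq xx]].
  by split=> [c|]; [rewrite dotC; exact: FTvN_le|rewrite FTvN_norm].
apply/subr0_eq/eqP/negPn/negP => /(dot_gt0 dW).
rewrite !(dotBl, dotBr) FTvN_norm (dotC dW q) => h.
have := xq x; lra.
Qed.

Lemma FTvN_support q c : range lambda q ->
  exists2 b, convex_hull (lambda @^-1` [set q]) b & dW (lambda c) q <= dV c b.
Proof.
move=> lq; have [x [lx cx]] := FTvN_attained hlambda c lq.
by exists x; [exact: sub_convex_hull|rewrite cx lx].
Qed.

(** [FTvN_fiberE] exhibits the fiber as closed; its inequalities at the Riesz vectors [c j] and
    [- c j] bound each coordinate. *)
Lemma compact_fiber q : compact (v2r @` (lambda @^-1` [set q])).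
Proof.
rewrite FTvN_fiberE.
have [c cE] := choice (@coord_dot R V dV).
pose box j := `[- dW (lambda (- c j)) q, dW (lambda (c j)) q].
have boxK : compact [set a : 'rV[R]_(dim V) | forall j, [set` box j] (a 0 j)].
  by apply: (@rV_compact _ _ (fun j => [set` box j])) => j; exact: segment_compact.
set S := [set x | _]; suff clS : closed (v2r @` S).
  apply: (subclosed_compact clS boxK) => _ [x [xq _] <-] j /=.
  by rewrite in_itv /= cE xq andbT lerNl -[- dV _ _]linearNr xq.
rewrite (_ : _ @` _ =
    (\bigcap_c0 (fun a => dV (r2v a) c0) @^-1` [set y | y <= dW (lambda c0) q]) `&`
    (fun a => dV (r2v a) (r2v a)) @^-1` [set y | y = dW q q]).
  apply: closedI.
    apply: closed_bigI => c0 _; apply: preimage_closed (@closed_le R _) => a _.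
    exact: continuous_dot_r2v.
  apply: preimage_closed (@closed_eq R _) => a _; exact: continuous_sqnorm_r2v.
apply/seteqP; split=> [_ [x [xq xx] <-]|a [aq aa]].
  by split=> [c0 _|] /=; rewrite v2rK.
by exists (r2v a); [split=> // c0; exact: aq|rewrite r2vK].
Qed.

(* For [a] in [A] the witness [B] is the hull of a fiber of [lambda]; convex
   combinations of points are matched by Minkowski combinations of witnesses. *)
Lemma hull_support (U : vectType R) (A : set U) (D : set V) (f : V -> U -> R) :
  (forall c u v t, f c (t *: u + (1 - t) *: v) = t * f c u + (1 - t) * f c v) ->
  (forall a, A a -> exists q, [/\ range lambda q, lambda @^-1` [set q] `<=` D &
     forall c, f c a <= dW (lambda c) q]) ->
  forall a, convex_hull A a ->
  exists B : set V, [/\ B `<=` convex_hull D,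
    convex_set (B : set (convex_lmodType V)), compact (v2r @` B) &
    forall c, exists2 b, B b & f c a <= dV c b].
Proof.
move=> fconv fA; apply: convex_hull_sub => [|a /fA[q [lq qD fq]]]; last first.
  exists (convex_hull (lambda @^-1` [set q])); split.
  - exact: convex_hullS.
  - exact: convex_convex_hull.
  - exact/compact_convex_hull/compact_fiber.
  - move=> c; have [b Bb le_b] := FTvN_support c lq.
    by exists b => //; exact: le_trans (fq c) _.
apply/convex_setP => a1 a2 t t01 [B1 [B1D B1conv B1c fB1]] [B2 [B2D B2conv B2c fB2]].
(* The weight ranges over a singleton to match the form of [compact_conv_comb]. *)
exists [set z | exists t' x y, [/\ [set t] t', B1 x, B2 y & z = t' *: x + (1 - t') *: y]].
split.
- move=> _ [_ [x [y [-> /B1D Dx /B2D Dy ->]]]].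
  by move/convex_setP: (@convex_convex_hull _ _ D); exact.
- apply/convex_setP => _ _ p p01 [_ [x1 [y1 [-> Bx1 By1 ->]]]]
    [_ [x2 [y2 [-> Bx2 By2 ->]]]].
  exists t, (p *: x1 + (1 - p) *: x2), (p *: y1 + (1 - p) *: y2); split=> //.
  + by move/convex_setP: B1conv; exact.
  + by move/convex_setP: B2conv; exact.
  + rewrite !scalerDr !scalerA addrACA; congr (_ + _ + (_ + _)); congr (_ *: _);
      exact: mulrC.
- by apply: compact_conv_comb => //; exact: compact_set1.
- move=> c; have [b1 Bb1 le1] := fB1 c; have [b2 Bb2 le2] := fB2 c.
  exists (t *: b1 + (1 - t) *: b2); first by exists t, b1, b2.
  move/andP: t01 => [t0 t1]; rewrite fconv dotDr !dotZr lerD // ler_wpM2l //.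
  by rewrite subr_ge0.
Qed.

(** [f] is abstract because the two inclusions use different functionals, affine in the point of
    [U]. *)
Lemma mem_hull (U : vectType R) (A : set U) (D : set V) (f : V -> U -> R) x a :
  (forall c u v t, f c (t *: u + (1 - t) *: v) = t * f c u + (1 - t) * f c v) ->
  (forall a, A a -> exists q, [/\ range lambda q, lambda @^-1` [set q] `<=` D &
     forall c, f c a <= dW (lambda c) q]) ->
  convex_hull A a -> (forall c, dV c x <= f c a) -> convex_hull D x.
Proof.
move=> fconv fA /(hull_support fconv fA)[B [BD Bconv Bc fB]] xa.
apply: BD; apply: (mem_compact_convex (dV := dV) Bconv Bc) => c.
have [b Bb le_b] := fB c.
by exists b => //; exact: le_trans (xa c) le_b.
Qed.

End FTvN.

Theorem corollary3p3 (R : realType) (V W : vectType R)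
    (dV : {dot V for (@idfun R)}) (dW : {dot W for (@idfun R)})
    (lambda : V -> W) (mu : W -> W)
    (hlambda : FTvN_system dV dW lambda)
    (hmu : reduced_system dW lambda mu)
    (C : set W) (hC0 : C !=set0) (hC : spectral_set mu C) :
  convex_hull (lambda @^-1` C) = lambda @^-1` (convex_hull C).
Proof.
have [hFmu mufix muran] := hmu; have [Q CQ] := hC.
have mul x : mu (lambda x) = lambda x by apply/mufix/imageT.
have mumu w : mu (mu w) = mu w by apply: mufix; rewrite -muran; exact: imageT.
(* Spectral sets are [mu]-invariant since [mu] is idempotent. *)
have Cmu w : C (mu w) <-> C w by rewrite CQ /= mumu.
apply/seteqP; split=> x /= xC.
  (* As [lambda] is nonlinear, pairing [mu w] with [lambda] need not be affine on [V]; pairing with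
     [d] is, and it agrees at [x]. *)
  have lift w : exists d, lambda d = mu w /\ dV x d = dW (lambda x) (mu w).
    have : range lambda (mu w) by rewrite -muran; exact: imageT.
    by case/(FTvN_attained hlambda x) => d [ld xd]; exists d; rewrite xd ld.
  have [d dP] := choice lift.
  apply: (mem_hull hFmu (f := fun w => dV (d w)) _ _ xC) => [w u v t|y Cy|w].
  - by rewrite dotDr !dotZr.
  - exists (lambda y); split=> [|z /= zy|w]; first by rewrite muran; exact: imageT.
      by apply/Cmu; rewrite zy.
    by have [<- _] := dP w; exact: FTvN_le.
  - have [ld xd] := dP w; rewrite (dotC dV) xd (dotC dW) -{2}(mul x).
    exact: FTvN_le.
apply: (mem_hull hlambda (f := fun c => dW (lambda c)) _ _ xC) => [c u v t|w Cw|c].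
- by rewrite dotDr !dotZr.
(* [w] itself may lie outside the range of [lambda]; P1 for [mu] allows replacing it by [mu w]. *)
- exists (mu w); split=> [|z /= zw|c]; first by rewrite -muran; exact: imageT.
    by rewrite /= zw; apply/Cmu.
  by have := FTvN_le hFmu (lambda c) w; rewrite mul.
- exact: FTvN_le.
Qed.
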